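(* Assume that $g(x,y)>0$ for all $(x,y)\in\mathsf X\times\mathsf Y$, and that for every $\eta>0$ there exists an LD-set function $\mathsf C_\eta$ such that $\Upsilon_{\mathsf C_\eta(y)^c}(y)\le \eta\,\Upsilon_{\mathsf X}(y)$ for all $y\in\mathsf Y$; for each $\eta>0$ fix such a $\mathsf C_\eta$ and let $\Lambda_\eta$ be defined from it as in the context. Let $\{Y_k\}_{k\ge0}$ be a $\mathsf Y$-valued stochastic process on $(\Omega,\mathcal F,\mathbb P_\star)$, let $\mathsf C$ be an LD-set function, and let $\nu,\nu'$ be probability measures on $(\mathsf X,\mathcal X)$. Then for any $M_0,M_1,M_2,M_3>0$, $\delta>0$ and $\alpha\in(0,1)$ there exist constants $\eta>0$ and $\beta\in(0,1)$ such that, for all $n\in\mathbb N$, $$\mathbb E_\star\Big[\big\|\phi_{\nu,n}[Y_{0:n}]-\phi_{\nu',n}[Y_{0:n}]\big\|_{\mathrm{TV}}\Big]\le 2\beta^n+r_0(\nu,n)+r_0(\nu',n)+\sum_{i=1}^4r_i(n),$$ where $$r_0(\nu,n)=\mathbb P_\star\big(\log\Phi_{\nu,\mathsf C}(Y_0,Y_1)\le -M_0n\big),$$ $$r_1(n)=\mathbb P_\star\Big(\sum_{k=2}^n\log\varepsilon^-_{\mathsf C}(Y_{k-1},Y_k)\le -M_1n\Big),$$ $$r_2(n)=\mathbb P_\star\Big(\sum_{k=0}^n\log\Upsilon_{\mathsf X}(Y_k)\ge M_2n\Big),$$ $$r_3(n)=\mathbb P_\star\Big(\sum_{k=2}^n\log\Psi_{\mathsf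 C}(Y_{k-1},Y_k)\le -M_3n\Big),$$ $$r_4(n)=\mathbb P_\star\big(\log\Lambda_\eta(Y_{0:n},\alpha)\ge-\delta n\big).$$
   Context: Setting. $(\mathsf X,\mathcal X)$ and $(\mathsf Y,\mathcal Y)$ are measurable spaces with countably generated $\sigma$-fields, $Q$ is a Markov transition kernel on $(\mathsf X,\mathcal X)$, $G$ is a Markov transition kernel from $(\mathsf X,\mathcal X)$ to $(\mathsf Y,\mathcal Y)$, and there is a measure $\mu$ on $(\mathsf Y,\mathcal Y)$ such that $G(x,\cdot)$ has density $g(x,\cdot)$ with respect to $\mu$ for every $x\in\mathsf X$. For a probability measure $\nu$ on $(\mathsf X,\mathcal X)$ and $y_{0:n}=(y_0,\dots,y_n)\in\mathsf Y^{n+1}$, the filtering distribution is $$\phi_{\nu,n}[y_{0:n}](A)=\frac{\int_{\mathsf X^{n+1}}\nu(dx_0)g(x_0,y_0)\prod_{i=1}^nQ(x_{i-1},dx_i)g(x_i,y_i)\mathbf 1_A(x_n)}{\int_{\mathsf X^{n+1}}\nu(dx_0)g(x_0,y_0)\prod_{i=1}^nQ(x_{i-1},dx_i)g(x_i,y_i)},\quad A\in\mathcal X$$ (the denominators are implicitly assumed to be in $(0,\infty)$, so that the filters are well defined). The process $\{Y_k\}$ at which the filter is evaluated need not be related to the kernels $Q,G$. $\mathbb E_\star$ is expectation under $\mathbb P_\star$. For probability measures, $\|\xi-\xi'\|_{\mathrm{TV}}=\sup_{A\in\mathcal X}|\xi(A)-\xi'(A)|$. LD-set function: a map $\mathsf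 C:\mathsf Y\to\mathcal X$ is a local Doeblin set function (LD-set function) if there is a map $(y,y')\mapsto(\varepsilon^-_{\mathsf C}(y,y'),\varepsilon^+_{\mathsf C}(y,y'))$ from $\mathsf Y\times\mathsf Y$ to $(0,\infty)^2$ and, for all $(y,y')\in\mathsf Y\times\mathsf Y$, a measure $\lambda_{y,y'}$ on $(\mathsf X,\mathcal X)$ such that $$\varepsilon^-_{\mathsf C}(y,y')\lambda_{y,y'}[A\cap\mathsf C(y')]\le Q[x,A\cap\mathsf C(y')]\le\varepsilon^+_{\mathsf C}(y,y')\lambda_{y,y'}[A\cap\mathsf C(y')]$$ for all $x\in\mathsf C(y)$ and $A\in\mathcal X$. Each LD-set function is considered together with a fixed choice of $\varepsilon^\pm_{\mathsf C}$ and $\lambda_{y,y'}$. Notation: for $A\in\mathcal X$, $\Upsilon_A(y)=\sup_{x\in A}g(x,y)$, and $A^c$ is the complement of $A$ in $\mathsf X$. For an LD-set function $\mathsf C$, $$\Phi_{\nu,\mathsf C}(y,y')=\int\nu(dx)\,g(x,y)\int_{\mathsf C(y')}Q(x,dx')\,g(x',y'),\qquad \Psi_{\mathsf C}(y,y')=\int_{\mathsf C(y')}g(x,y')\,\lambda_{y,y'}(dx),$$ and $\rho_{\mathsf C}(y,y')=1-\big(\varepsilon^-_{\mathsf C}(y,y')/\varepsilon^+_{\mathsf C}(y,y')\big)^2$. For $\alpha\in(0,1)$, $$\Lambda_\eta(y_{0:n},\alpha)=\max\Big\{\prod_{k=1}^n\rho_{\mathsf C_\eta}(y_{k-1},y_k)^{\delta_k}:\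 \{\delta_k\}_{k=1}^n\in\{0,1\}^n,\ \sum_{k=1}^n\delta_k\ge\alpha n\Big\}.$$ *)

(* Defs.v *)
From HB Require Import structures.
From mathcomp Require Export all_boot all_order all_algebra.
From mathcomp Require Export all_classical all_reals all_analysis.

Set Implicit Arguments.
Unset Strict Implicit.
Unset Printing Implicit Defensive.

Export Order.TTheory GRing.Theory Num.Theory.
Export numFieldNormedType.Exports.

Global Open Scope classical_set_scope.
Global Open Scope ring_scope.

Definition countably_generated d (T : measurableType d) : Prop :=
  exists F : nat -> set T, @measurable d T = <<s range F >>.

Section Defs.
Context (R : realType) (dX dY : measure_display)
  (X : measurableType dX) (Y : measurableType dY).
Variables (Q : R.-pker X ~> X) (g : X -> Y -> R).
Local Open Scope ereal_scope.

(* [propagate y n A x0] is the inner part of the (n+1)-fold integral,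
     \int Q(x0,dx1) g(x1,y1) ... \int Q(x_(n-1),dx_n) g(x_n,y_n) 1_A(x_n);
   an observation record y_{0:n} is the restriction to {0,...,n} of a sequence
   y : nat -> Y, the other terms of which are not used. *)
Fixpoint propagate (y : nat -> Y) (n : nat) (A : set X) (x : X) : \bar R :=
  match n with
  | 0%N => (\1_A x)%:E
  | m.+1 =>
      \int[Q x]_x' ((g x' (y 1%N))%:E * propagate (fun k => y k.+1) m A x')
  end.

Definition unnormalized_filter (nu : probability X R) (y : nat -> Y) (n : nat)
    (A : set X) : \bar R :=
  \int[nu]_x ((g x (y 0%N))%:E * propagate y n A x).

Definition filter_defined (nu : probability X R) (y : nat -> Y) (n : nat) :
    Prop :=
  0 < unnormalized_filter nu y n [set: X] < +oo.

Definition filtering (nu : probability X R) (y : nat -> Y) (n : nat)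
    (A : set X) : \bar R :=
  unnormalized_filter nu y n A / unnormalized_filter nu y n [set: X].

Definition tv_dist (xi xi' : set X -> \bar R) : \bar R :=
  ereal_sup [set `|xi A - xi' A| | A in measurable].

(* The supremum is taken in \bar R: it may be +oo, and it is -oo (instead of 0)
   for A = set0. *)
Definition Upsilon (A : set X) (y : Y) : \bar R :=
  ereal_sup [set (g x y)%:E | x in A].

Record LD_set_function := LDSetFunction {
  LD_set :> Y -> set X;
  LD_setP : forall y, measurable (LD_set y);
  eps_lo : Y -> Y -> R;
  eps_hi : Y -> Y -> R;
  eps_lo_gt0 : forall y y', (0 < eps_lo y y')%R;
  eps_hi_gt0 : forall y y', (0 < eps_hi y y')%R;
  LD_measure : Y -> Y -> {measure set X -> \bar R};
  LD_doeblin : forall y y' x A, LD_set y x -> measurable A ->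
    (eps_lo y y')%:E * LD_measure y y' (A `&` LD_set y')
      <= Q x (A `&` LD_set y')
      <= (eps_hi y y')%:E * LD_measure y y' (A `&` LD_set y') }.

Definition Phi (nu : probability X R) (C : LD_set_function) (y y' : Y) :
    \bar R :=
  \int[nu]_x ((g x y)%:E * \int[Q x]_(x' in C y') (g x' y')%:E).

Definition Psi (C : LD_set_function) (y y' : Y) : \bar R :=
  \int[LD_measure C y y']_(x in C y') (g x y')%:E.

Definition rho (C : LD_set_function) (y y' : Y) : R :=
  (1 - (eps_lo C y y' / eps_hi C y y') ^+ 2)%R.

(* The index k in {1,...,n} is i.+1 for i : 'I_n.  The base point -oo is
   irrelevant: delta = (1,...,1) is always admissible when alpha <= 1. *)
Definition Lambda (C : LD_set_function) (y : nat -> Y) (n : nat) (alpha : R) :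
    \bar R :=
  \big[maxe/-oo]_(delta : {ffun 'I_n -> bool} |
                    (alpha * n%:R <= (\sum_(i < n) delta i)%N%:R)%R)
    (\prod_(i < n) rho C (y i) (y i.+1) ^+ delta i)%R%:E.

End Defs.

(* Outer probability: it is defined for every event and agrees with P on the
   measurable ones. *)
Definition outer_prob d (T : measurableType d) (R : realType)
    (P : probability T R) (E : set T) : \bar R := mu_ext P E.

Lemma outer_probE d (T : measurableType d) (R : realType)
    (P : probability T R) (E : set T) : measurable E -> outer_prob P E = P E.
Proof. exact: measurable_mu_extE. Qed.

(* Main.v *)
From HB Require Import structures.
Require Import Defs.
From mathcomp Require Import measurable_realfun.
From mathcomp Require Import ring lra.

(** Write N(A) and N'(A) for the unnormalized filters started from nu and nu',
and X for the whole space. The difference of the two filters at A is the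
determinant N(A) N'(X) - N(X) N'(A) divided by N(X) N'(X). This determinant is
an expectation over two independent chains, weighted by their likelihoods, of a
function that is antisymmetric in the two chains.

Consider a step in which both chains go from D(y) to D(y'), where D is the
LD-set function attached to eta. On D(y') the two transition laws p and q
dominate r times each other, where r is the ratio of the Doeblin constants of D.
An antisymmetric function integrates to zero against p x p, so a proportion r^2
of the mass of p x q on D(y') x D(y') cancels, and the step contributes a factor
rho = 1 - r^2 ([coupling_le]). Iteration along the observations gives
[propagate_determinant_le] and [filter_determinant_le].

Along a given pair of paths, either at least alpha n steps carry the factor rho,
and their product is at most Lambda; or at least (1 - alpha) n / 2 times find
the pair outside D x D, since each such time spoils at most two steps, and each
of them costs a factor eta with respect to the square of the supremum of the
likelihood ([contraction_path_le]).

Outside the exceptional events, N(X) and N'(X) are at least exp(-(M0 + M1 + M3)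
n): restrict the integral to the paths that are in C(Y_k) at every time k >= 1,
C being the other LD-set function ([unnormalized_filter_ge]). The product of the
suprema of the likelihood is at most exp(M2 n), and Lambda is at most
exp(-delta n). With
  eta = exp(-2 K / (1 - alpha)),  K = 2 (M0 + M1 + M2 + M3) + delta,
both contributions to the total variation distance are at most exp(-delta n)
([tv_dist_filtering_exp]). On the exceptional events the distance is at most 1,
and the outer probability is subadditive. *)

Set Implicit Arguments.
Unset Strict Implicit.
Unset Printing Implicit Defensive.

(** * Comparison of integrals *)

Section domination.
Local Open Scope ereal_scope.
Context d (T : measurableType d) (R : realType).

Lemma integral_dominated (p q : {measure set T -> \bar R}) (S : set T) (r : R)
    (f : T -> \bar R) :
  measurable S -> (0 <= r)%R ->
  (forall A, measurable A -> r%:E * p (A `&` S) <= q (A `&` S)) ->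
  (forall x, 0 <= f x) -> measurable_fun setT f ->
  r%:E * \int[p]_(x in S) f x <= \int[q]_(x in S) f x.
Proof.
move=> mS r0 pq f0 mf.
rewrite (eq_measure_integral (mrestr p mS)); last first.
  by move=> A mA AS; rewrite /= /mrestr setIidl.
rewrite [leRHS](eq_measure_integral (mrestr q mS)); last first.
  by move=> A mA AS; rewrite /= /mrestr setIidl.
rewrite -(ge0_integral_mscale (mrestr p mS) mS (NngNum r0)) //.
  by apply: ge0_le_measure_integral => // A mA; exact: pq.
exact: measurable_funTS.
Qed.

End domination.

Section bounded_measurable.
Context d (T : measurableType d) (R : realType).
Implicit Types (P : probability T R) (f g : T -> R).

(** A class of functions with finite integrals against every probability, on
which the integral is therefore linear and monotone. *)
Definition bounded_measurable f :=
  measurable_fun setT f /\ exists M, forall x, `|f x| <= M.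

Lemma bounded_measurable_integrable P f :
  bounded_measurable f -> P.-integrable setT (EFin \o f).
Proof.
move=> [mf [M fM]]; apply: measurable_bounded_integrable => //.
  by rewrite -ge0_fin_numE//; exact: fin_num_measure.
exists M; split; first exact: num_real.
by move=> M' MM' x _ /=; apply: le_trans (fM x) (ltW MM').
Qed.

Lemma bounded_measurable_cst (c : R) : bounded_measurable (cst c).
Proof. by split => //; exists `|c|. Qed.

Lemma bounded_measurableD f g : bounded_measurable f -> bounded_measurable g ->
  bounded_measurable (fun x => f x + g x).
Proof.
move=> [mf [M fM]] [mg [N gN]]; split; first exact: measurable_funD.
by exists (M + N) => x; rewrite (le_trans (ler_normD _ _))// lerD.
Qed.

Lemma bounded_measurableM f g : bounded_measurable f -> bounded_measurable g ->
  bounded_measurable (fun x => f x * g x).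
Proof.
move=> [mf [M fM]] [mg [N gN]]; split; first exact: measurable_funM.
by exists (M * N) => x; rewrite normrM ler_pM.
Qed.

Lemma bounded_measurableB f g : bounded_measurable f -> bounded_measurable g ->
  bounded_measurable (fun x => f x - g x).
Proof.
move=> [mf [M fM]] [mg [N gN]]; split; first exact: measurable_funB.
by exists (M + N) => x; rewrite (le_trans (ler_normB _ _))// lerD.
Qed.

Lemma bounded_measurable_norm f : bounded_measurable f ->
  bounded_measurable (fun x => `|f x|).
Proof.
move=> [mf [M fM]]; split; first exact: measurableT_comp.
by exists M => x; rewrite normr_id.
Qed.

Lemma bounded_measurable_indic (S : set T) : measurable S ->
  bounded_measurable (\1_S : T -> R).
Proof.
move=> mS; split; first exact: measurable_indic.
by exists 1 => x; rewrite indicE; case: (_ \in _); rewrite ?normr1// normr0.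
Qed.

End bounded_measurable.

Section product.
Context d (T : measurableType d) (R : realType).
Implicit Types (p q m : probability T R).

(** The type ascription fixes one form of the product measure, so that the
rewriting lemmas on probabilities apply to it syntactically. *)
Definition product_prob p q : probability (T * T)%type R := (p \x q)%E.

Lemma bounded_measurable_fst (f : T -> R) : bounded_measurable f ->
  bounded_measurable (fun z : T * T => f z.1).
Proof. by move=> [mf [M fM]]; split; [exact: measurableT_comp | exists M]. Qed.

Lemma bounded_measurable_snd (f : T -> R) : bounded_measurable f ->
  bounded_measurable (fun z : T * T => f z.2).
Proof. by move=> [mf [M fM]]; split; [exact: measurableT_comp | exists M]. Qed.

Lemma Rintegral_prod p q (f g : T -> R) :
  bounded_measurable f -> bounded_measurable g ->
  (forall x, 0 <= f x) -> (forall x, 0 <= g x) ->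
  \int[product_prob p q]_z (f z.1 * g z.2) = \int[p]_x f x * \int[q]_x g x.
Proof.
move=> bf bg f0 g0.
rewrite /Rintegral.
have -> : (\int[(p \x q)%E]_z (f z.1 * g z.2)%:E =
  (\int[q]_x (g x)%:E) * (\int[p]_x (f x)%:E))%E.
  rewrite fubini_tonelli1/=; last first.
  - by move=> x; rewrite lee_fin mulr_ge0.
  - apply/measurable_EFinP; apply: measurable_funM.
      by case: (bounded_measurable_fst bf).
    by case: (bounded_measurable_snd bg).
  rewrite -ge0_integralZl//=; last first.
  - by apply: integral_ge0 => x _; rewrite lee_fin.
  - by move=> x _; rewrite lee_fin.
  - by apply/measurable_EFinP; case: bf.
  apply: eq_integral => x _; rewrite /fubini_F /=.
  under eq_integral do rewrite EFinM.
  rewrite ge0_integralZl//; first by rewrite muleC.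
  - by apply/measurable_EFinP; case: bg.
  - by move=> y _; rewrite lee_fin.
  - by rewrite lee_fin.
have If := bounded_measurable_integrable p bf.
have Ig := bounded_measurable_integrable q bg.
rewrite mulrC; apply: fineM; first exact: (integrable_fin_num measurableT Ig).
exact: (integrable_fin_num measurableT If).
Qed.

(** As [F] vanishes when the second coordinate is outside [S], its inner
integral only sees the restrictions of [p] and [q] to [S]. *)
Lemma Rintegral_prod_dominated m p q (S : set T) (r : R) (F : T * T -> R) :
  measurable S -> 0 <= r ->
  (forall A, measurable A -> (r%:E * p (A `&` S) <= q (A `&` S))%E) ->
  bounded_measurable F -> (forall z, 0 <= F z) ->
  (forall z, ~ S z.2 -> F z = 0) ->
  r * \int[product_prob m p]_z F z <= \int[product_prob m q]_z F z.
Proof.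
move=> mS r0 pq bF F0 FS.
have mF : measurable_fun setT (EFin \o F) by apply/measurable_EFinP; case: bF.
have secE (k : probability T R) x :
    (\int[k]_(y in S) (F (x, y))%:E = fubini_F k (EFin \o F) x)%E.
  rewrite [LHS]integral_mkcond; apply: eq_integral => y _.
  rewrite patchE; case: ifPn => // yS.
  by rewrite /= FS// => Sy; move: yS; rewrite mem_set.
have FE (k : probability T R) :
    (\int[product_prob m k]_z (F z)%:E =
     \int[m]_x \int[k]_(y in S) (F (x, y))%:E)%E.
  by rewrite fubini_tonelli1//; apply: eq_integral => x _; rewrite secE.
have mFk (k : probability T R) :
    measurable_fun setT (fun x => \int[k]_(y in S) (F (x, y))%:E)%E.
  rewrite (_ : (fun _ => _) = fubini_F k (EFin \o F)).
    by apply: measurable_fun_fubini_tonelli_F => // x; rewrite lee_fin.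
  by apply/funext => x; rewrite secE.
have fE (k : probability T R) : (product_prob m k).-integrable setT (EFin \o F).
  exact: bounded_measurable_integrable.
rewrite -lee_fin EFinM !fineK; last 2 first.
- exact: (integrable_fin_num measurableT (fE _)).
- exact: (integrable_fin_num measurableT (fE _)).
rewrite !FE -ge0_integralZl//; last first.
  by move=> x _; apply: integral_ge0 => y _; rewrite lee_fin.
apply: ge0_le_integral => //.
- move=> x _; apply: mule_ge0; first by rewrite lee_fin.
  by apply: integral_ge0 => y _; rewrite lee_fin.
- exact: measurable_funeM.
- move=> x _; apply: integral_dominated => //.
  + by move=> y; rewrite lee_fin.
  + have := measurableT_comp mF (pair1_measurable x). exact.
Qed.

End product.

Section bounded_Rintegral.
Context d (T : measurableType d) (R : realType) (P : probability T R).
Implicit Types f g : T -> R.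

Lemma bounded_RintegralD f g : bounded_measurable f -> bounded_measurable g ->
  \int[P]_x (f x + g x) = \int[P]_x f x + \int[P]_x g x.
Proof.
by move=> bf bg; apply: RintegralD => //; apply: bounded_measurable_integrable.
Qed.

Lemma bounded_RintegralB f g : bounded_measurable f -> bounded_measurable g ->
  \int[P]_x (f x - g x) = \int[P]_x f x - \int[P]_x g x.
Proof.
by move=> bf bg; apply: RintegralB => //; apply: bounded_measurable_integrable.
Qed.

Lemma bounded_RintegralZ f c : bounded_measurable f ->
  \int[P]_x (c * f x) = c * \int[P]_x f x.
Proof.
by move=> bf; apply: RintegralZl => //; apply: bounded_measurable_integrable.
Qed.

Lemma le_bounded_Rintegral f g :
  bounded_measurable f -> bounded_measurable g ->
  (forall x, f x <= g x) -> \int[P]_x f x <= \int[P]_x g x.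
Proof.
move=> bf bg fg.
by apply: le_Rintegral => //; apply: bounded_measurable_integrable.
Qed.

Lemma probability_Rintegral_cst c : \int[P]_x c = c.
Proof.
rewrite Rintegral_cst// -[RHS]mulr1; congr (_ * _).
exact: (congr1 fine (probability_setT P)).
Qed.

End bounded_Rintegral.

(** * The coupling step *)

Section coupling.
Context d (T : measurableType d) (R : realType).
Implicit Types (p q : probability T R) (f u : T -> R).

(** Let D be the determinant below as a function of (x, x'), and W the indicator
of S x S. Then W (|D| - D) is nonnegative, hence its integral against p x q is
at least r times its integral against p x p. There W D integrates to zero by
antisymmetry, so what remains is W |D|, whose integral against p x p is at least
r times that against p x q. Thus the integral of D loses r^2 W |D| with respect
to the integral of |D|. *)
Let coupling_upper p q (S : set T) (r : R) f1 f2 u (L K : R) :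
  measurable S -> 0 <= r ->
  (forall A, measurable A -> (r%:E * p (A `&` S) <= q (A `&` S))%E) ->
  (forall A, measurable A -> (r%:E * q (A `&` S) <= p (A `&` S))%E) ->
  bounded_measurable f1 -> bounded_measurable f2 -> bounded_measurable u ->
  (forall x, 0 <= f1 x) -> (forall x, 0 <= f2 x) -> (forall x, 0 <= u x) ->
  (forall x x', (1 - r ^+ 2 * (\1_S x * \1_S x')) *
    `|f1 x * f2 x' - f2 x * f1 x'| <= L * (u x * u x') + K) ->
  \int[p]_x f1 x * \int[q]_x f2 x - \int[p]_x f2 x * \int[q]_x f1 x <=
    L * (\int[p]_x u x * \int[q]_x u x) + K.
Proof.
move=> mS r0 pq qp b1 b2 bu f10 f20 u0 hyp.
pose D (z : T * T) := f1 z.1 * f2 z.2 - f2 z.1 * f1 z.2.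
pose W (z : T * T) : R := \1_S z.1 * \1_S z.2.
have prodb f g : bounded_measurable f -> bounded_measurable g ->
    bounded_measurable (fun z : T * T => f z.1 * g z.2).
  move=> bf bg; apply: bounded_measurableM; first exact: bounded_measurable_fst.
  exact: bounded_measurable_snd.
have b12 := prodb _ _ b1 b2; have b21 := prodb _ _ b2 b1.
have bD : bounded_measurable D by exact: bounded_measurableB.
have bN := bounded_measurable_norm bD.
have bS : bounded_measurable (\1_S : T -> R) by exact: bounded_measurable_indic.
have bW : bounded_measurable W by exact: prodb.
have W0 z : 0 <= W z by rewrite mulr_ge0.
have W1 z : W z <= 1.
  rewrite /W !indicE.
  by do 2 case: (_ \in _); rewrite ?mulr1 ?mulr0 ?mul0r ?ler01.
have WS z : ~ S z.2 -> W z = 0.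
  by move=> Sz; rewrite /W [X in _ * X]indicE memNset// mulr0.
pose F z := W z * `|D z|; pose G z := W z * (`|D z| - D z).
have bF : bounded_measurable F by exact: bounded_measurableM.
have bND : bounded_measurable (fun z => `|D z| - D z).
  exact: bounded_measurableB.
have bG : bounded_measurable G by exact: bounded_measurableM.
have bWD : bounded_measurable (fun z => W z * D z).
  exact: bounded_measurableM.
have ND0 z : 0 <= `|D z| - D z by rewrite subr_ge0 ler_norm.
have DE : \int[product_prob p q]_z D z =
    \int[p]_x f1 x * \int[q]_x f2 x - \int[p]_x f2 x * \int[q]_x f1 x.
  by rewrite bounded_RintegralB// !Rintegral_prod.
have WD0 : \int[product_prob p p]_z (W z * D z) = 0.
  pose h1 x := \1_S x * f1 x; pose h2 x := \1_S x * f2 x.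
  have bh1 : bounded_measurable h1 by exact: bounded_measurableM.
  have bh2 : bounded_measurable h2 by exact: bounded_measurableM.
  have h10 x : 0 <= h1 x by rewrite mulr_ge0.
  have h20 x : 0 <= h2 x by rewrite mulr_ge0.
  transitivity (\int[product_prob p p]_z (h1 z.1 * h2 z.2 - h2 z.1 * h1 z.2)).
    by apply: eq_Rintegral => z _; rewrite /h1 /h2 /W /D; ring.
  rewrite bounded_RintegralB ?Rintegral_prod//; [|exact: prodb..].
  by rewrite mulrC subrr.
have FG : \int[product_prob p p]_z F z = \int[product_prob p p]_z G z.
  transitivity (\int[product_prob p p]_z (F z - W z * D z)).
    by rewrite bounded_RintegralB// WD0 subr0.
  apply: eq_Rintegral => z _; rewrite /F /G; ring.
have step1 : r * \int[product_prob p q]_z F z <= \int[product_prob p p]_z F z.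
  apply: (Rintegral_prod_dominated p mS r0 qp bF).
    by move=> z; rewrite mulr_ge0.
  by move=> z /WS; rewrite /F => ->; rewrite mul0r.
have step2 : r * \int[product_prob p p]_z G z <= \int[product_prob p q]_z G z.
  apply: (Rintegral_prod_dominated p mS r0 pq bG).
    by move=> z; rewrite mulr_ge0.
  by move=> z /WS; rewrite /G => ->; rewrite mul0r.
have step3 : \int[product_prob p q]_z G z <=
    \int[product_prob p q]_z `|D z| - \int[product_prob p q]_z D z.
  rewrite -bounded_RintegralB//; apply: le_bounded_Rintegral => // z.
  by rewrite ler_piMl.
have step4 : \int[product_prob p q]_z `|D z| -
    r ^+ 2 * \int[product_prob p q]_z F z <=
    L * (\int[p]_x u x * \int[q]_x u x) + K.
  have buu : bounded_measurable (fun z : T * T => u z.1 * u z.2).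
    exact: prodb.
  have cst c : bounded_measurable (fun _ : T * T => c : R).
    exact: bounded_measurable_cst.
  have bLuu : bounded_measurable (fun z : T * T => L * (u z.1 * u z.2)).
    exact: bounded_measurableM.
  have br2F : bounded_measurable (fun z => r ^+ 2 * F z).
    exact: bounded_measurableM.
  have -> : L * (\int[p]_x u x * \int[q]_x u x) + K =
      \int[product_prob p q]_z (L * (u z.1 * u z.2) + K).
    rewrite (bounded_RintegralD _ bLuu (cst K)) bounded_RintegralZ//.
    by rewrite Rintegral_prod// probability_Rintegral_cst.
  rewrite -bounded_RintegralZ// -bounded_RintegralB//.
  apply: le_bounded_Rintegral.
  - exact: bounded_measurableB.
  - exact: bounded_measurableD.
  move=> [x x'] /=; have := hyp x x'; rewrite /F /W /D/=.
  by rewrite mulrBl mul1r -mulrA.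
rewrite -DE.
have : r ^+ 2 * \int[product_prob p q]_z F z <= \int[product_prob p q]_z G z.
  by rewrite expr2 -mulrA (le_trans _ step2)// ler_wpM2l// -FG.
move: step3 step4; lra.
Qed.

(** When S is empty or r = 0, this is the trivial bound by the integral of the
absolute value; the factor 1 - r^2 is the gain of the coupling on S x S. *)
Lemma coupling_le p q (S : set T) (r : R) f1 f2 u (L K : R) :
  measurable S -> 0 <= r ->
  (forall A, measurable A -> (r%:E * p (A `&` S) <= q (A `&` S))%E) ->
  (forall A, measurable A -> (r%:E * q (A `&` S) <= p (A `&` S))%E) ->
  bounded_measurable f1 -> bounded_measurable f2 -> bounded_measurable u ->
  (forall x, 0 <= f1 x) -> (forall x, 0 <= f2 x) -> (forall x, 0 <= u x) ->
  (forall x x', (1 - r ^+ 2 * (\1_S x * \1_S x')) *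
    `|f1 x * f2 x' - f2 x * f1 x'| <= L * (u x * u x') + K) ->
  `|\int[p]_x f1 x * \int[q]_x f2 x - \int[p]_x f2 x * \int[q]_x f1 x| <=
    L * (\int[p]_x u x * \int[q]_x u x) + K.
Proof.
move=> mS r0 pq qp b1 b2 bu f10 f20 u0 hyp; rewrite ler_norml.
(* Exchanging p and q changes the sign of the determinant. *)
have up := coupling_upper mS r0 pq qp b1 b2 bu f10 f20 u0 hyp.
have := coupling_upper mS r0 qp pq b1 b2 bu f10 f20 u0 hyp.
rewrite up andbT [\int[q]_x u x * _]mulrC.
rewrite [\int[q]_x f1 x * _]mulrC [\int[q]_x f2 x * _]mulrC; lra.
Qed.

End coupling.

(** * Likelihoods of bounded observation records *)

Section probability_bound.
Context d (T : measurableType d) (R : realType) (P : probability T R).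

Lemma integral_le_cst (f : T -> \bar R) (M : R) : measurable_fun setT f ->
  (forall x, (0 <= f x <= M%:E)%E) -> (\int[P]_x f x <= M%:E)%E.
Proof.
move=> mf fM; rewrite -[leRHS]mule1 -(probability_setT P) -integral_cst//.
by apply: ge0_le_integral => // x _; case/andP: (fM x).
Qed.

End probability_bound.

Section filter.
Context (R : realType) (dX dY : measure_display)
  (X : measurableType dX) (Y : measurableType dY).
Variables (Q : R.-pker X ~> X) (g : X -> Y -> R).
Hypothesis mg : forall t, measurable_fun setT (g ^~ t).
Hypothesis g_gt0 : forall x t, 0 < g x t.
Implicit Types (y : nat -> Y) (n : nat) (A : set X) (nu : probability X R).

Let g_ge0 x t : 0 <= g x t. Proof. exact: ltW. Qed.

(** The kernel provides its values as measures only; [transition x] is [Q x]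
with its structure of probability. *)
Section transition_probability.
Variable x : X.
Let Qx : set X -> \bar R := Q x.
HB.instance Definition _ := Measure.on Qx.
HB.instance Definition _ :=
  Measure_isProbability.Build _ _ _ Qx (prob_kernel x).
Definition transition : probability X R := Qx.
End transition_probability.

Lemma propagate_ge0 n y A x : (0 <= propagate Q g y n A x)%E.
Proof.
elim: n y x => [|n IHn] y x /=; first by rewrite lee_fin.
by apply: integral_ge0 => x' _; rewrite mule_ge0// lee_fin.
Qed.

Lemma measurable_propagate n y A : measurable A ->
  measurable_fun setT (propagate Q g y n A).
Proof.
move=> mA; elim: n y => [|n IHn] y /=.
  by apply/measurable_EFinP; exact: measurable_indic.
apply: measurable_fun_integral_kernel.
- exact: measurable_kernel.
- by move=> x'; rewrite mule_ge0 ?propagate_ge0// lee_fin.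
- by apply: emeasurable_funM; [exact/measurable_EFinP | exact: IHn].
Qed.

Lemma unnormalized_filter_ge0 nu n y A :
  (0 <= unnormalized_filter Q g nu y n A)%E.
Proof.
by apply: integral_ge0 => x _; rewrite mule_ge0 ?propagate_ge0// lee_fin.
Qed.

(** [v t] bounds the likelihood of the observation [t]; it is only required to
do so along the observation record at hand. *)
Variable v : Y -> R.

Definition bound_above y n :=
  forall k, (k < n)%N -> forall x, g x (y k) <= v (y k).

Lemma propagate_le n y A x : measurable A -> bound_above (fun k => y k.+1) n ->
  (propagate Q g y n A x <= (\prod_(k < n) v (y k.+1))%:E)%E.
Proof.
move=> mA; elim: n y x => [|n IHn] y x vP.
  by rewrite big_ord0 lee_fin /= indicE; case: (_ \in _); rewrite ?ler01.
have v0 k : (k < n.+1)%N -> 0 <= v (y k.+1).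
  by move=> kn; apply: le_trans (vP _ kn x).
have pe x' : (propagate Q g (fun k => y k.+1) n A x' <=
    (\prod_(k < n) v (y k.+2))%:E)%E.
  by apply: IHn => k kn; exact: (vP k.+1).
rewrite big_ord_recl/=; apply: (integral_le_cst (transition x)).
  apply: emeasurable_funM; first exact/measurable_EFinP.
  exact: measurable_propagate.
move=> x'; rewrite mule_ge0 ?propagate_ge0 ?lee_fin//= EFinM.
by rewrite lee_pmul ?propagate_ge0 ?lee_fin// (vP 0%N).
Qed.

Definition rpropagate y n A x : R := fine (propagate Q g y n A x).


Lemma rpropagate_ge0 y n A x : 0 <= rpropagate y n A x.
Proof. by rewrite fine_ge0// propagate_ge0. Qed.

Lemma rpropagateE y n A x : measurable A ->
  bound_above (fun k => y k.+1) n ->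
  (rpropagate y n A x)%:E = propagate Q g y n A x.
Proof.
move=> mA vP; rewrite fineK// ge0_fin_numE ?propagate_ge0//.
exact: le_lt_trans (propagate_le x mA vP) (ltry _).
Qed.

Lemma rpropagateS y n A x : measurable A ->
  bound_above (fun k => y k.+1) n.+1 ->
  rpropagate y n.+1 A x =
  \int[transition x]_x' (g x' (y 1%N) * rpropagate (fun k => y k.+1) n A x').
Proof.
move=> mA vP; rewrite /rpropagate /= /Rintegral; congr fine.
apply: eq_integral => x' _; rewrite EFinM rpropagateE// => k kn.
exact: (vP k.+1).
Qed.

Definition runnormalized nu y n A : R :=
  fine (unnormalized_filter Q g nu y n A).

Lemma unnormalized_filterE nu y n A : measurable A -> bound_above y n.+1 ->
  unnormalized_filter Q g nu y n A =
  (\int[nu]_x (g x (y 0%N) * rpropagate y n A x)%:E)%E.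
Proof.
move=> mA vP; apply: eq_integral => x _; rewrite EFinM rpropagateE// => k kn.
exact: (vP k.+1).
Qed.

Lemma bounded_rpropagate y n A : measurable A ->
  bound_above (fun k => y k.+1) n -> bounded_measurable (rpropagate y n A).
Proof.
move=> mA vP; split.
  by apply: measurableT_comp => //; exact: measurable_propagate.
exists (\prod_(k < n) v (y k.+1)) => x; rewrite ger0_norm ?rpropagate_ge0//.
by rewrite -lee_fin rpropagateE//; exact: propagate_le.
Qed.

Lemma bounded_likelihood_rpropagate y n A : measurable A ->
  bound_above y n.+1 ->
  bounded_measurable (fun x => g x (y 0%N) * rpropagate y n A x).
Proof.
move=> mA vP; apply: bounded_measurableM.
  split; first exact: mg.
  by exists (v (y 0%N)) => x; rewrite ger0_norm// (vP 0%N).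
by apply: bounded_rpropagate => // k kn; exact: (vP k.+1).
Qed.

(** * Contraction along the observations *)

Section contraction.
Variables (C : LD_set_function Y Q) (eta : R).
Hypothesis eta_gt0 : 0 < eta.

Definition both_in t x x' : bool := (x \in C t) && (x' \in C t).

(** The factor of a step, where [b] and [b'] tell whether the pair of chains is
in [C t] x [C t] before the step and in [C t'] x [C t'] after it. The positive
part matters: nothing forces [eps_lo <= eps_hi] when [C t] is empty or does not
communicate with [C t'], and then [rho] may be negative. *)
Definition contraction t t' (b b' : bool) : R :=
  if b && b' then Num.max (rho C t t') 0 else 1.

Definition small_outside y n := forall k, (k < n)%N ->
  forall x, ~ C (y k) x -> g x (y k) <= eta * v (y k).

Lemma contraction_ge0 t t' b b' : 0 <= contraction t t' b b'.
Proof.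
by rewrite /contraction; case: ifP => // _; rewrite le_max lexx orbT.
Qed.

Lemma contraction_le1 t t' b b' : contraction t t' b b' <= 1.
Proof.
rewrite /contraction; case: ifP => // _; rewrite ge_max ler01 andbT.
by rewrite gerBl exprn_ge0// divr_ge0// ltW// ?eps_lo_gt0 ?eps_hi_gt0.
Qed.

(** Both transition laws are compared with the local Doeblin measure, which is
thereby eliminated. *)
Lemma doeblin_minorization t t' x x' A : C t x -> C t x' -> measurable A ->
  ((eps_lo C t t' / eps_hi C t t')%:E * Q x (A `&` C t') <=
   Q x' (A `&` C t'))%E.
Proof.
move=> Cx Cx' mA.
have /andP[_ hi] := LD_doeblin t' Cx mA.
have /andP[lo _] := LD_doeblin t' Cx' mA.
apply: le_trans lo; rewrite EFinM -muleA.
rewrite lee_pmul2l ?lte_fin ?eps_lo_gt0// lee_pdivrMl ?eps_hi_gt0//.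
Qed.

(** If the pair is outside [C] x [C], the small likelihood of one of its
components absorbs the factor [eta^-1]. *)
Lemma likelihood_pair_le y n z z' : bound_above y n.+1 ->
  small_outside y n.+1 ->
  g z (y 0%N) * g z' (y 0%N) * eta^-1 ^+ (~~ both_in (y 0%N) z z') <=
  v (y 0%N) ^+ 2.
Proof.
move=> vP etaP; rewrite /both_in expr2.
have [Cz|nCz] := boolP (z \in C (y 0%N)); last first.
  rewrite /= expr1 mulrAC ler_pM ?divr_ge0 ?(ltW eta_gt0)// ?(vP 0%N)//.
  by rewrite ler_pdivrMr// mulrC etaP//; move: nCz; rewrite notin_setE.
have [Cz'|nCz'] := boolP (z' \in C (y 0%N)); last first.
  rewrite /= expr1 -mulrA ler_pM ?divr_ge0 ?(ltW eta_gt0)// ?(vP 0%N)//.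
  by rewrite ler_pdivrMr// mulrC etaP//; move: nCz'; rewrite notin_setE.
by rewrite /= expr0 mulr1 ler_pM// (vP 0%N).
Qed.

(** The integral over pairs of paths is never written: the hypothesis on all bit
sequences [b] (when the pair of chains is in [C] x [C]) is the pathwise bound
that is to be integrated. The constant [c] is the product of the contraction
factors already met, and [E] absorbs the factors [eta^-1] of the times already
spent outside [C] x [C]; this makes the hypothesis hereditary, so that induction
on [n] applies. In the conclusion, [L] multiplies the two likelihoods, and [E]
the trivial bound on them. *)
Lemma propagate_determinant_le A n : measurable A ->
  forall y (c L E : R) x x', 0 <= c -> 0 <= L -> 0 <= E ->
  bound_above (fun k => y k.+1) n -> small_outside (fun k => y k.+1) n ->
  (forall b : nat -> bool, b 0%N = both_in (y 0%N) x x' ->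
     c * \prod_(i < n) contraction (y i) (y i.+1) (b i) (b i.+1) <=
     L + E * \prod_(i < n.+1) eta^-1 ^+ (~~ b i)) ->
  c * `|rpropagate y n A x * rpropagate y n setT x' -
        rpropagate y n setT x * rpropagate y n A x'| <=
  L * (rpropagate y n setT x * rpropagate y n setT x') +
  E * eta^-1 ^+ (~~ both_in (y 0%N) x x') * \prod_(k < n) v (y k.+1) ^+ 2.
Proof.
move=> mA; elim: n => [|n IHn] y c L E x x' c0 L0 E0 vP etaP cLE.
  rewrite /rpropagate /= !indicT !mulr1 !mul1r big_ord0 mulr1.
  have := cLE (fun=> both_in (y 0%N) x x') erefl.
  rewrite big_ord0 mulr1 big_ord_recl big_ord0 mulr1; apply: le_trans.
  apply: ler_piMr => //; rewrite !indicE.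
  by do 2 case: (_ \in _); rewrite ?subrr ?subr0 ?sub0r ?normrN ?normr1 ?normr0.
have vP' : bound_above (fun k => y k.+2) n by move=> k kn; exact: (vP k.+1).
have etaP' : small_outside (fun k => y k.+2) n.
  by move=> k kn; exact: (etaP k.+1).
set y' := fun k => y k.+1.
pose b := both_in (y 0%N) x x'; rewrite -/b.
(* For a pair outside C x C no comparison of the transition laws is available,
   and r = 0 turns the coupling step into the trivial bound. *)
pose r := if b then eps_lo C (y 0%N) (y 1%N) / eps_hi C (y 0%N) (y 1%N) else 0.
pose u z := g z (y 1%N) * rpropagate y' n setT z.
pose h z := g z (y 1%N) * rpropagate y' n A z.
have bu : bounded_measurable u by exact: bounded_likelihood_rpropagate.
have bh : bounded_measurable h by exact: bounded_likelihood_rpropagate.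
have u0 z : 0 <= u z by rewrite mulr_ge0 ?rpropagate_ge0.
have h0 z : 0 <= h z by rewrite mulr_ge0 ?rpropagate_ge0.
have r0 : 0 <= r.
  rewrite /r; case: ifP => // _.
  by rewrite divr_ge0// ltW// ?eps_lo_gt0 ?eps_hi_gt0.
have E'0 : 0 <= E * eta^-1 ^+ (~~ b).
  by rewrite mulr_ge0// exprn_ge0// invr_ge0 ltW.
have prod0 : 0 <= \prod_(k < n) v (y k.+2) ^+ 2.
  by apply: prodr_ge0 => k _; rewrite sqr_ge0.
have bch : bounded_measurable (fun z => c * h z).
  by apply: bounded_measurableM => //; exact: bounded_measurable_cst.
have step z z' : (1 - r ^+ 2 * (\1_(C (y 1%N)) z * \1_(C (y 1%N)) z')) *
    `|c * h z * u z' - u z * (c * h z')| <=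
    L * (u z * u z') + E * eta^-1 ^+ (~~ b) * \prod_(k < n.+1) v (y k.+1) ^+ 2.
  set b' := both_in (y 1%N) z z'.
  have wP : 1 - r ^+ 2 * (\1_(C (y 1%N)) z * \1_(C (y 1%N)) z') <=
      contraction (y 0%N) (y 1%N) b b'.
    rewrite /r /contraction /b' /both_in !indicE.
    case: (b); do 2 case: (_ \in _);
      rewrite /= ?expr0n/= ?mulr1 ?mulr0 ?mul0r ?subr0// le_max lexx//.
  (* A bit sequence b1 that starts at the new pair (z, z') is extended by the
     bit b of the pair (x, x'). *)
  have := IHn y' (c * contraction (y 0%N) (y 1%N) b b') L (E * eta^-1 ^+ (~~ b))
    z z' (mulr_ge0 c0 (contraction_ge0 _ _ _ _)) L0 E'0 vP' etaP'.
  rewrite -/b' => /(_ _)/wrap[].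
    move=> b1 b10.
    have := cLE (fun k => if k is k'.+1 then b1 k' else b) erefl.
    by rewrite big_ord_recl [in X in _ <= X]big_ord_recl /= b10 !mulrA.
  set D := `|_|; move=> IH.
  have -> : `|c * h z * u z' - u z * (c * h z')| =
      g z (y 1%N) * g z' (y 1%N) * (c * D).
    rewrite /D -[c in RHS]ger0_norm// -[g z _]ger0_norm// -[g z' _]ger0_norm//.
    by rewrite -!normrM; congr `|_|; rewrite /h /u; ring.
  have gg0 : 0 <= g z (y 1%N) * g z' (y 1%N) by rewrite mulr_ge0.
  apply: (@le_trans _ _ (g z (y 1%N) * g z' (y 1%N) *
      (c * contraction (y 0%N) (y 1%N) b b' * D))).
    rewrite mulrCA ler_wpM2l// mulrCA -mulrA ler_wpM2l//.
    by rewrite ler_wpM2r// normr_ge0.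
  apply: le_trans (ler_wpM2l gg0 IH) _.
  rewrite mulrDr lerD//.
    by rewrite /u le_eqVlt; apply/orP; left; apply/eqP; ring.
  rewrite big_ord_recl /=.
  have := likelihood_pair_le z z' vP etaP; rewrite -/b' => gv.
  have := ler_wpM2r (mulr_ge0 E'0 prod0) gv.
  by congr (_ <= _); rewrite /y'/bump/=; ring.
have minor w w' : (b -> C (y 0%N) w /\ C (y 0%N) w') ->
    forall B, measurable B ->
    (r%:E * transition w (B `&` C (y 1%N)) <=
     transition w' (B `&` C (y 1%N)))%E.
  rewrite /r; case: (b) => [/(_ isT)[Cw Cw'] B mB|_ B mB]; last first.
    by rewrite mul0e.
  exact: doeblin_minorization.
have bP : b -> C (y 0%N) x /\ C (y 0%N) x' by move=> /andP[]; rewrite !inE.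
have ch0 z : 0 <= c * h z by rewrite mulr_ge0.
have := coupling_le (LD_setP C _) r0 (minor _ _ bP)
  (minor _ _ (fun bt => let: conj Cx Cx' := bP bt in conj Cx' Cx))
  bch bu bu ch0 u0 u0 step.
rewrite !bounded_RintegralZ// -!rpropagateS//.
apply: le_trans; rewrite le_eqVlt; apply/orP; left; apply/eqP.
by rewrite -[c in LHS]ger0_norm// -normrM; congr `|_|; ring.
Qed.

(** The initial laws are not comparable, so the first integration uses the
coupling step with r = 0. *)
Lemma filter_determinant_le nu nu' A n y (L E : R) : measurable A ->
  0 <= L -> 0 <= E -> bound_above y n.+1 -> small_outside y n.+1 ->
  (forall b : nat -> bool,
     \prod_(i < n) contraction (y i) (y i.+1) (b i) (b i.+1) <=
     L + E * \prod_(i < n.+1) eta^-1 ^+ (~~ b i)) ->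
  `|runnormalized nu y n A * runnormalized nu' y n setT -
    runnormalized nu y n setT * runnormalized nu' y n A| <=
  L * (runnormalized nu y n setT * runnormalized nu' y n setT) +
  E * \prod_(k < n.+1) v (y k) ^+ 2.
Proof.
move=> mA L0 E0 vP etaP LE.
have vP' : bound_above (fun k => y k.+1) n by move=> k kn; exact: (vP k.+1).
have etaP' : small_outside (fun k => y k.+1) n.
  by move=> k kn; exact: (etaP k.+1).
pose f B x := g x (y 0%N) * rpropagate y n B x.
have NE xi B : measurable B -> runnormalized xi y n B = \int[xi]_x f B x.
  by move=> mB; rewrite /runnormalized unnormalized_filterE.
have bf B : measurable B -> bounded_measurable (f B).
  by move=> mB; exact: bounded_likelihood_rpropagate.
have f0 B x : 0 <= f B x by rewrite mulr_ge0 ?rpropagate_ge0.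
rewrite !NE//; apply: (@coupling_le _ X R nu nu' setT 0) => //.
- by move=> B mB; rewrite mul0e.
- by move=> B mB; rewrite mul0e.
- exact: bf.
- exact: bf.
- exact: bf.
move=> x x'; rewrite expr0n/= mul0r subr0 mul1r.
have -> : `|f A x * f setT x' - f setT x * f A x'| =
   g x (y 0%N) * g x' (y 0%N) * `|rpropagate y n A x * rpropagate y n setT x' -
     rpropagate y n setT x * rpropagate y n A x'|.
  rewrite -[g x _ in RHS]ger0_norm// -[g x' _ in RHS]ger0_norm// -!normrM.
  by congr `|_|; rewrite /f; ring.
have gg0 : 0 <= g x (y 0%N) * g x' (y 0%N) by rewrite mulr_ge0.
have LE1 (b : nat -> bool) : b 0%N = both_in (y 0%N) x x' ->
    1 * \prod_(i < n) contraction (y i) (y i.+1) (b i) (b i.+1) <=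
    L + E * \prod_(i < n.+1) eta^-1 ^+ (~~ b i) by move=> _; rewrite mul1r.
have := propagate_determinant_le mA ler01 L0 E0 vP' etaP' LE1.
rewrite mul1r => /(ler_wpM2l gg0)/le_trans; apply; rewrite mulrDr lerD//.
  by rewrite le_eqVlt; apply/orP; left; apply/eqP; rewrite /f; ring.
rewrite big_ord_recl /=.
have prod0 : 0 <= \prod_(k < n) v (y k.+1) ^+ 2.
  by apply: prodr_ge0 => k _; rewrite sqr_ge0.
have := ler_wpM2r (mulr_ge0 E0 prod0) (likelihood_pair_le x x' vP etaP).
by congr (_ <= _); rewrite /bump/=; ring.
Qed.

End contraction.

(** * Lower bound on the normalizing constant *)

Section lower_bound.
Variable C : LD_set_function Y Q.
Local Open Scope ereal_scope.

Lemma Psi_ge0 t t' : 0 <= Psi g C t t'.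
Proof. by apply: integral_ge0 => x _; rewrite lee_fin. Qed.

(** Sums of extended logarithms replace products: [expeR] is a morphism on the
whole of [\bar R], also when some [Psi] is zero or infinite. *)
Definition log_minorant t t' := (ln (eps_lo C t t'))%:E + lne (Psi g C t t').

Lemma minorant_le_transition t t' x : C t x ->
  expeR (log_minorant t t') <= \int[Q x]_(x' in C t') (g x' t')%:E.
Proof.
move=> Cx; rewrite expeRD lneK; last by rewrite in_itv/= Psi_ge0 leey.
rewrite /= lnK ?posrE ?eps_lo_gt0//.
apply: integral_dominated.
- exact: LD_setP.
- by rewrite ltW// eps_lo_gt0.
- by move=> A mA; case/andP: (LD_doeblin t' Cx mA).
- by move=> x'; rewrite lee_fin.
- exact/measurable_EFinP.
Qed.

Lemma propagate_ge_transition n y x (c : \bar R) :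
  0 <= c -> (forall x', C (y 1%N) x' ->
    c <= propagate Q g (fun k => y k.+1) n setT x') ->
  c * \int[Q x]_(x' in C (y 1%N)) (g x' (y 1%N))%:E <=
  propagate Q g y n.+1 setT x.
Proof.
move=> c0 cP /=; have mC := LD_setP C (y 1%N).
have mgE : measurable_fun setT (EFin \o g ^~ (y 1%N)) by exact/measurable_EFinP.
have mp : measurable_fun setT (fun x' =>
    (g x' (y 1%N))%:E * propagate Q g (fun k => y k.+1) n setT x').
  by apply: emeasurable_funM => //; exact: measurable_propagate.
have p0 x' : 0 <= (g x' (y 1%N))%:E * propagate Q g (fun k => y k.+1) n setT x'.
  by rewrite mule_ge0 ?propagate_ge0// lee_fin.
rewrite -ge0_integralZl//; last 2 first.
- exact: measurable_funTS.
- by move=> x' _; rewrite lee_fin.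
apply: (@le_trans _ _ (\int[Q x]_(x' in C (y 1%N))
  ((g x' (y 1%N))%:E * propagate Q g (fun k => y k.+1) n setT x'))).
  apply: ge0_le_integral => //.
  - by move=> x' _; rewrite mule_ge0// lee_fin.
  - by apply: measurable_funeM; exact: measurable_funTS.
  - exact: measurable_funTS.
  - by move=> x' /cP cx'; rewrite muleC lee_wpmul2l// lee_fin.
by apply: ge0_subset_integral.
Qed.

Lemma propagate_ge n y x : C (y 0%N) x ->
  expeR (\sum_(i < n) log_minorant (y i) (y i.+1)) <= propagate Q g y n setT x.
Proof.
elim: n y x => [|n IHn] y x Cx.
  by rewrite big_ord0 expeR0 /= indicT.
rewrite big_ord_recl expeRD muleC.
apply: le_trans (propagate_ge_transition (n := n) x (expeR_ge0 _) _).
  by apply: lee_wpmul2l; [exact: expeR_ge0|exact: minorant_le_transition].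
by move=> x' Cx'; exact: (IHn (fun k => y k.+1)).
Qed.

Lemma Phi_ge0 nu t t' : 0 <= Phi g nu C t t'.
Proof.
apply: integral_ge0 => x _; rewrite mule_ge0 ?lee_fin//.
by apply: integral_ge0 => x' _; rewrite lee_fin.
Qed.

(** Keep only the paths with x_k in C(y_k) for all k >= 1. The first step is
accounted for by [Phi], since x_0 is arbitrary. *)
Lemma unnormalized_filter_ge nu n y :
  Phi g nu C (y 0%N) (y 1%N) *
    expeR (\sum_(i < n) log_minorant (y i.+1) (y i.+2)) <=
  unnormalized_filter Q g nu y n.+1 setT.
Proof.
set c := expeR _; have c0 : 0 <= c by exact: expeR_ge0.
have mC := LD_setP C (y 1%N).
pose J x := \int[Q x]_(x' in C (y 1%N)) (g x' (y 1%N))%:E.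
have J0 x : 0 <= J x by apply: integral_ge0 => x' _; rewrite lee_fin.
have mJ : measurable_fun setT J.
  rewrite (_ : J =
      fun x => \int[Q x]_x' ((EFin \o g ^~ (y 1%N)) \_ (C (y 1%N))) x').
    apply: measurable_fun_integral_kernel; first exact: measurable_kernel.
      by move=> x; apply: erestrict_ge0 => x' _ /=; rewrite lee_fin.
    apply/(measurable_restrictT _ mC).1; apply: measurable_funTS.
    exact/measurable_EFinP.
  by apply/funext => x; rewrite /J integral_mkcond.
have mgE : measurable_fun setT (EFin \o g ^~ (y 0%N)) by exact/measurable_EFinP.
rewrite muleC -ge0_integralZl//; last 2 first.
- exact: emeasurable_funM.
- by move=> x _; apply: mule_ge0; [rewrite lee_fin|exact: J0].
apply: ge0_le_integral => //.
- move=> x _; apply: mule_ge0 => //.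
  by apply: mule_ge0; [rewrite lee_fin|exact: J0].
- by apply: measurable_funeM; exact: emeasurable_funM.
- by apply: emeasurable_funM => //; exact: measurable_propagate.
move=> x _; rewrite muleCA lee_wpmul2l ?lee_fin//.
rewrite /=; apply: propagate_ge_transition => // x' Cx'.
exact: (propagate_ge n (y := fun k => y k.+1)).
Qed.

End lower_bound.

End filter.

(** * Counting good and bad times along a path *)

Section path.
Context (R : realType) (dX dY : measure_display)
  (X : measurableType dX) (Y : measurableType dY) (Q : R.-pker X ~> X).
Variable C : LD_set_function Y Q.

(** A time at which [b] is false spoils the step that ends there and the one
that starts there, and no other. *)
Lemma bad_transitions_le (b : nat -> bool) n :
  (\sum_(i < n) ~~ (b i && b i.+1) <= 2 * \sum_(i < n.+1) ~~ b i)%N.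
Proof.
apply: (@leq_trans (\sum_(i < n) ~~ b i + \sum_(i < n) ~~ b i.+1)%N).
  by rewrite -big_split; apply: leq_sum => i _; case: (b i); case: (b i.+1).
rewrite mul2n -addnn leq_add//; first by rewrite big_ord_recr leq_addr.
by rewrite big_ord_recl leq_addl.
Qed.

(** The set of steps with both ends good is an admissible [delta] in [Lambda] if
it has at least [alpha * n] elements; otherwise the bad times are numerous
enough for the powers of [eta^-1] to compensate [E]. *)
Lemma contraction_path_le (y : nat -> Y) n (alpha eta L E : R)
    (b : nat -> bool) :
  0 <= L -> 0 <= E -> 0 < eta -> (Lambda C y n alpha <= L%:E)%E ->
  (forall m : nat, (1 - alpha) * n%:R <= 2 * m%:R -> 1 <= E * eta^-1 ^+ m) ->
  \prod_(i < n) contraction C (y i) (y i.+1) (b i) (b i.+1) <=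
  L + E * \prod_(i < n.+1) eta^-1 ^+ (~~ b i).
Proof.
move=> L0 E0 eta0 LL EP; rewrite -(big_morph _ (exprD _) (expr0 _)).
have q0 m : 0 <= E * eta^-1 ^+ m by rewrite mulr_ge0// exprn_ge0// invr_ge0 ltW.
pose del : {ffun 'I_n -> bool} := [ffun i : 'I_n => b i && b i.+1].
have [le_del|lt_del] := lerP (alpha * n%:R) (\sum_(i < n) del i)%N%:R.
  rewrite -[leLHS]addr0; apply: lerD; last exact: q0.
  (* A negative rho on a good step makes the product of contractions vanish. *)
  have [/existsP[i /andP[di ri]]|/existsPn noneg] :=
    boolP [exists i : 'I_n, del i && (rho C (y i) (y i.+1) < 0)].
    rewrite (bigD1 i)//= /contraction; move: di; rewrite ffunE => ->.
    by rewrite max_r ?mul0r// ltW.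
  rewrite -lee_fin; apply: le_trans LL; apply: bigmax_sup le_del _.
  rewrite lee_fin le_eqVlt; apply/orP; left; apply/eqP.
  apply: eq_bigr => i _; rewrite /contraction.
  have -> : b i && b i.+1 = del i by rewrite ffunE.
  have := noneg i; case: (del i) => //=.
  by rewrite -leNgt => r0; rewrite max_l// expr1.
apply: (@le_trans _ _ 1).
  by apply: prodr_ile1 => i _; rewrite contraction_ge0 contraction_le1.
apply: (@le_trans _ _ (E * eta^-1 ^+ (\sum_(i < n.+1) ~~ b i))); last first.
  by rewrite lerDr.
apply: EP.
have := bad_transitions_le b n.
rewrite -(ler_nat R) natrM => /(le_trans _); apply.
have /(congr1 (fun k => k%:R : R)) :
    (\sum_(i < n) del i + \sum_(i < n) ~~ (b i && b i.+1) = n)%N.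
  rewrite -[RHS](card_ord n) -sum1_card -big_split; apply: eq_bigr => i _.
  by rewrite ffunE; case: (_ && _).
rewrite natrD; lra.
Qed.

End path.

(** * Integrals and outer probability *)

Section outer.
Context d (T : measurableType d) (R : realType) (P : probability T R).
Local Open Scope ereal_scope.

(** The integral of a nonnegative function is the supremum of those of the
simple functions below it, hence is monotone even without measurability, and [f]
is below [c] plus the indicator of any measurable cover of [B]. *)
Lemma integral_le_outer_prob (f : T -> \bar R) (B : set T) (c : R) :
  (0 <= c)%R -> (forall w, 0 <= f w) -> (forall w, f w <= 1) ->
  (forall w, ~ B w -> f w <= c%:E) ->
  \int[P]_w f w <= c%:E + outer_prob P B.
Proof.
move=> c0 f0 f1 fc.
rewrite -leeBlDl//; apply: le_ereal_inf_tmp => _ [F [mF BF] <-].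
rewrite leeBlDl//.
pose U := \bigcup_k F k; have mU : measurable U by exact: bigcup_measurable.
apply: (@le_trans _ _ (c%:E + P U)); last first.
  by apply: leeD => //; apply: measure_sigma_subadditive.
have fU w : f w <= (c + \1_U w)%:E.
  rewrite indicE; have [/set_mem Uw|/negP nUw] := boolP (w \in U).
    by apply: le_trans (f1 w) _; rewrite lee_fin lerDr.
  by rewrite addr0; apply: fc => Bw; apply: nUw; apply/mem_set/BF.
have -> : c%:E + P U = \int[P]_w (c + \1_U w)%:E.
  under eq_integral do rewrite EFinD.
  rewrite ge0_integralD//; last first.
    by apply/measurable_EFinP; exact: measurable_indic.
  rewrite integral_cst// probability_setT mule1 integral_indic//.
  by rewrite setIT.
rewrite !ge0_integralE//; last first.
  by move=> w _; rewrite lee_fin addr_ge0.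
apply: le_ereal_sup => _ [h hf <-]; exists h => // w.
by apply: le_trans (hf w) _; rewrite !patchE in_setT.
Qed.

Lemma outer_probU2 (A B : set T) :
  outer_prob P (A `|` B) <= outer_prob P A + outer_prob P B.
Proof. exact: outer_measureU2. Qed.

End outer.

(** * Total variation distance of filters *)

Section tv.
Context (R : realType) (dX dY : measure_display)
  (X : measurableType dX) (Y : measurableType dY).
Variables (Q : R.-pker X ~> X) (g : X -> Y -> R).
Hypothesis mg : forall t, measurable_fun setT (g ^~ t).
Hypothesis g_gt0 : forall x t, 0 < g x t.
Local Open Scope ereal_scope.

Lemma le_propagate y n A B x : measurable A -> measurable B -> A `<=` B ->
  propagate Q g y n A x <= propagate Q g y n B x.
Proof.
move=> mA mB AB; elim: n y x => [|n IHn] y x /=.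
  rewrite lee_fin !indicE ler_nat; case: (x \in A) / idP => //.
  by move=> /set_mem/AB/mem_set ->.
apply: ge0_le_integral => //.
- by move=> x' _; rewrite mule_ge0 ?propagate_ge0// lee_fin ltW.
- apply: emeasurable_funM; first exact/measurable_EFinP.
  exact: measurable_propagate.
- apply: emeasurable_funM; first exact/measurable_EFinP.
  exact: measurable_propagate.
- by move=> x' _; rewrite lee_wpmul2l ?lee_fin// ltW.
Qed.

Lemma le_unnormalized_filter nu y n A B :
  measurable A -> measurable B -> A `<=` B ->
  unnormalized_filter Q g nu y n A <= unnormalized_filter Q g nu y n B.
Proof.
move=> mA mB AB; apply: ge0_le_integral => //.
- by move=> x' _; rewrite mule_ge0 ?propagate_ge0// lee_fin ltW.
- apply: emeasurable_funM; first exact/measurable_EFinP.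
  exact: measurable_propagate.
- apply: emeasurable_funM; first exact/measurable_EFinP.
  exact: measurable_propagate.
- by move=> x' _; rewrite lee_wpmul2l ?lee_fin ?le_propagate// ltW.
Qed.

Lemma filteringE nu y n A : filter_defined Q g nu y n -> measurable A ->
  [/\ filtering Q g nu y n A =
        (runnormalized Q g nu y n A / runnormalized Q g nu y n setT)%:E,
      (0 <= runnormalized Q g nu y n A <= runnormalized Q g nu y n setT)%R &
      unnormalized_filter Q g nu y n setT = (runnormalized Q g nu y n setT)%:E].
Proof.
move=> /andP[N0 Ny] mA.
have NA0 : 0 <= unnormalized_filter Q g nu y n A.
  exact: unnormalized_filter_ge0.
have NAT := le_unnormalized_filter nu y n mA measurableT (@subsetT _ A).
rewrite /filtering /runnormalized.
have fT : unnormalized_filter Q g nu y n setT \is a fin_num.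
  by rewrite ge0_fin_numE// ltW.
have fA : unnormalized_filter Q g nu y n A \is a fin_num.
  by rewrite ge0_fin_numE// (le_lt_trans NAT).
rewrite -lee_fin -[(fine _ <= _)%R]lee_fin !fineK// NA0 NAT; split => //.
rewrite -{1}(fineK fT) -{1}(fineK fA) inver ifF//.
by apply/negbTE; rewrite -eqe fineK// gt_eqF.
Qed.

Lemma runnormalized_gt0 nu y n : filter_defined Q g nu y n ->
  (0 < runnormalized Q g nu y n setT)%R.
Proof.
move=> nuP; have [_ _ NE] := filteringE nuP measurableT.
by move: nuP; rewrite /filter_defined NE lte_fin => /andP[].
Qed.

Lemma tv_dist_filtering_le nu nu' y n (c : R) :
  filter_defined Q g nu y n -> filter_defined Q g nu' y n ->
  (forall A, measurable A ->
    `|runnormalized Q g nu y n A / runnormalized Q g nu y n setT -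
      runnormalized Q g nu' y n A / runnormalized Q g nu' y n setT| <= c)%R ->
  tv_dist (filtering Q g nu y n) (filtering Q g nu' y n) <= c%:E.
Proof.
move=> nuP nuP' cP; apply: ge_ereal_sup => _ [A mA <-].
have [-> _ _] := filteringE nuP mA; have [-> _ _] := filteringE nuP' mA.
by rewrite lee_fin cP.
Qed.

Lemma tv_dist_filtering_le1 nu nu' y n :
  filter_defined Q g nu y n -> filter_defined Q g nu' y n ->
  tv_dist (filtering Q g nu y n) (filtering Q g nu' y n) <= 1.
Proof.
move=> nuP nuP'; apply: tv_dist_filtering_le => // A mA.
have [_ /andP[a0 a1] _] := filteringE nuP mA.
have [_ /andP[b0 b1] _] := filteringE nuP' mA.
have T0 := runnormalized_gt0 nuP; have T0' := runnormalized_gt0 nuP'.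
have a2 :
    (0 <= runnormalized Q g nu y n A / runnormalized Q g nu y n setT <= 1)%R.
  by rewrite divr_ge0 ?(ltW T0)//= ler_pdivrMr// mul1r.
have b2 :
    (0 <= runnormalized Q g nu' y n A / runnormalized Q g nu' y n setT <= 1)%R.
  by rewrite divr_ge0 ?(ltW T0')//= ler_pdivrMr// mul1r.
rewrite ler_norml; move: a2 b2 => /andP[? ?] /andP[? ?]; lra.
Qed.

Lemma tv_dist_ge0 (xi xi' : set X -> \bar R) : 0 <= tv_dist xi xi'.
Proof.
apply: (@le_trans _ _ `|xi set0 - xi' set0|); first exact: abse_ge0.
by apply: ereal_sup_ubound; exists set0 => //; exact: measurable0.
Qed.

End tv.

(** * Typical observation records *)

Section typical.
Context (R : realType) (dX dY : measure_display)
  (X : measurableType dX) (Y : measurableType dY).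
Variables (Q : R.-pker X ~> X) (g : X -> Y -> R).
Hypothesis mg : forall t, measurable_fun setT (g ^~ t).
Hypothesis g_gt0 : forall x t, 0 < g x t.
Implicit Types (nu : probability X R) (y : nat -> Y) (C : LD_set_function Y Q).

Lemma probability_inhabited nu : exists x : X, True.
Proof.
apply: contrapT => noX; have : nu setT = 1%E by exact: probability_setT.
rewrite (_ : [set: X] = set0) ?measure0.
  by move/eqP; rewrite eqe eq_sym oner_eq0.
by rewrite -subset0 => x _; apply: noX; exists x.
Qed.

Lemma Upsilon_ge (A : set X) x t : A x -> ((g x t)%:E <= Upsilon g A t)%E.
Proof. by move=> Ax; apply: ereal_sup_ubound; exists x. Qed.

Lemma lne_Upsilon_neqNy (x : X) t : lne (Upsilon g [set: X] t) != -oo%E.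
Proof.
rewrite -expeR_eq0; have U0 : (0 < Upsilon g [set: X] t)%E.
  by apply: lt_le_trans (Upsilon_ge _ (I : [set: X] x)); rewrite lte_fin.
by rewrite lneK ?gt_eqF// in_itv/= leey ltW.
Qed.

Lemma runnormalized_ge C nu y n (M0 M1 M3 : R) :
  filter_defined Q g nu y n.+1 ->
  (M0%:E < lne (Phi g nu C (y 0%N) (y 1%N)))%E ->
  M1 < \sum_(2 <= k < n.+2) ln (eps_lo C (y k.-1) (y k)) ->
  (M3%:E < \sum_(2 <= k < n.+2) lne (Psi g C (y k.-1) (y k)))%E ->
  expR (M0 + M1 + M3) <= runnormalized Q g nu y n.+1 setT.
Proof.
move=> nuP h0 h1 h3; have [_ _ NE] := filteringE mg g_gt0 nuP measurableT.
rewrite -lee_fin -NE.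
apply: le_trans (unnormalized_filter_ge mg g_gt0 C nu n y).
rewrite -(lneK (x := Phi _ _ _ _ _)); last by rewrite in_itv/= Phi_ge0 ?leey.
rewrite -expeRD -[leLHS]/(expeR (M0 + M1 + M3)%:E) lee_expeR big_split /=.
have shift (V : nmodType) (F : Y -> Y -> V) :
    \sum_(2 <= k < n.+2) F (y k.-1) (y k) = \sum_(i < n) F (y i.+1) (y i.+2).
  by rewrite big_add1 big_add1 big_mkord.
rewrite sumEFin -(shift _ (fun t t' => ln (eps_lo C t t'))).
rewrite -(shift _ (fun t t' => lne (Psi g C t t'))).
by rewrite -addrA 2!EFinD; apply/ltW/lteD => //; apply: lteD.
Qed.

(** As no likelihood vanishes, no term of the sum is [-oo]; a bound on the sum
then excludes [+oo] from every term. *)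
Lemma prod_Upsilon_le (x : X) y n (M2 : R) :
  (\sum_(0 <= k < n) lne (Upsilon g [set: X] (y k)) < M2%:E)%E ->
  [/\ forall k, (k < n)%N -> Upsilon g [set: X] (y k) =
        (fine (Upsilon g [set: X] (y k)))%:E &
      \prod_(k < n) fine (Upsilon g [set: X] (y k)) <= expR M2].
Proof.
rewrite big_mkord => h2.
have finU k : (k < n)%N -> Upsilon g [set: X] (y k) =
    (fine (Upsilon g [set: X] (y k)))%:E.
  move=> kn; have := lne_Upsilon_neqNy x (y k).
  case E : (Upsilon _ _ _) => [u||]//= _.
  suff S : (\sum_(i < n) lne (Upsilon g [set: X] (y i)) = +oo)%E.
    by rewrite S in h2.
  apply/esum_eqyP => [i _|]; first exact: lne_Upsilon_neqNy.
  by exists (Ordinal kn); rewrite E; split => //; rewrite mem_index_enum.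
split=> //.
have v0 (k : 'I_n) : 0 < fine (Upsilon g [set: X] (y k)).
  rewrite -lte_fin -finU//.
  by apply: lt_le_trans (Upsilon_ge _ (I : [set: X] x)); rewrite lte_fin.
rewrite (eq_bigr (fun k : 'I_n => expR (ln (fine (Upsilon g [set: X] (y k)))))).
  rewrite -expR_sum ler_expR -lee_fin -sumEFin; apply/ltW.
  rewrite (eq_bigr (fun k : 'I_n => lne (Upsilon g [set: X] (y k))))// => k _.
  by rewrite [in RHS]finU// lne_EFin.
by move=> k _; rewrite lnK ?posrE.
Qed.

(** [C] gives the lower bound on the normalizing constants, and [C'] the
contraction. The choice of [eta] makes [eta^-1] to the power (1 - alpha) n / 2
equal to exp(K n), where K = 2 (M0 + M1 + M2 + M3) + delta; the part 2 (M0 + M1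
+ M2 + M3) of K pays for the normalizing constants and the suprema of the
likelihood. *)
Lemma tv_dist_filtering_exp C C' nu nu' y n (eta alpha delta M0 M1 M2 M3 : R) :
  (0 < n)%N ->
  filter_defined Q g nu y n -> filter_defined Q g nu' y n ->
  0 < eta -> alpha < 1 ->
  ln eta = - (2 * (2 * (M0 + M1 + M2 + M3) + delta) / (1 - alpha)) ->
  0 <= 2 * (M0 + M1 + M2 + M3) + delta ->
  (forall t, (Upsilon g (~` C' t) t <= eta%:E * Upsilon g [set: X] t)%E) ->
  ((- M0 * n%:R)%:E < lne (Phi g nu C (y 0%N) (y 1%N)))%E ->
  ((- M0 * n%:R)%:E < lne (Phi g nu' C (y 0%N) (y 1%N)))%E ->
  - M1 * n%:R < \sum_(2 <= k < n.+1) ln (eps_lo C (y k.-1) (y k)) ->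
  (\sum_(0 <= k < n.+1) lne (Upsilon g [set: X] (y k)) < (M2 * n%:R)%:E)%E ->
  ((- M3 * n%:R)%:E < \sum_(2 <= k < n.+1) lne (Psi g C (y k.-1) (y k)))%E ->
  (lne (Lambda C' y n alpha) < (- delta * n%:R)%:E)%E ->
  (tv_dist (filtering Q g nu y n) (filtering Q g nu' y n) <=
   (2 * expR (- delta) ^+ n)%:E)%E.
Proof.
case: n => // n _.
set K := 2 * _ + delta; set N := n.+1.
move=> nuP nuP' eta0 al1 etaE K0 etaP h0 h0' h1 h2 h3 h4.
have [x _] := probability_inhabited nu.
have [finU Vle] := prod_Upsilon_le x h2.
pose v t := fine (Upsilon g [set: X] t).
set V := \prod_(k < n.+2) _ in Vle.
set T := runnormalized Q g nu y N setT.
set T' := runnormalized Q g nu' y N setT.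
have T0 : 0 < T by exact: runnormalized_gt0.
have T0' : 0 < T' by exact: runnormalized_gt0.
have Tge : expR (- (M0 + M1 + M3) * N%:R) <= T.
  have := runnormalized_ge nuP h0 h1 h3; congr (_ <= _); congr expR; ring.
have Tge' : expR (- (M0 + M1 + M3) * N%:R) <= T'.
  have := runnormalized_ge nuP' h0' h1 h3; congr (_ <= _); congr expR; ring.
set L := expR (- delta * N%:R); pose E := expR (- K * N%:R).
have LE : expR (- delta) ^+ N = L by rewrite -expRM_natr.
have L0 : 0 <= L by exact: expR_ge0.
have E0 : 0 <= E by exact: expR_ge0.
have LamL : (Lambda C' y N alpha <= L%:E)%E.
  have [Lam0|Lam0] := leP (Lambda C' y N alpha) 0%E.
    by apply: le_trans Lam0 _; rewrite lee_fin.
  have -> : Lambda C' y N alpha = expeR (lne (Lambda C' y N alpha)).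
    by rewrite lneK// in_itv/= leey ltW.
  by rewrite -[L%:E]/(expeR (- delta * N%:R)%:E) lee_expeR ltW.
have Eeta m : (1 - alpha) * N%:R <= 2 * m%:R -> 1 <= E * eta^-1 ^+ m.
  move=> mP; have -> : eta^-1 = expR (- ln eta) by rewrite expRN lnK.
  rewrite -expRM_natr -expRD -[leLHS]expR0 ler_expR etaE opprK.
  have al0 : 0 < 1 - alpha by rewrite subr_gt0.
  rewrite mulrAC -(ler_pM2r al0) mul0r mulrDl divfK ?gt_eqF//.
  have := ler_wpM2l K0 mP; lra.
have vP k : (k < N.+1)%N -> forall z, g z (y k) <= v (y k).
  by move=> kn z; rewrite -lee_fin -finU//; exact: Upsilon_ge.
have outP k : (k < N.+1)%N ->
    forall z, ~ C' (y k) z -> g z (y k) <= eta * v (y k).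
  move=> kn z Cz; rewrite -lee_fin EFinM -finU//; apply: le_trans (etaP _).
  exact: Upsilon_ge.
have pathP (b : nat -> bool) := contraction_path_le b L0 E0 eta0 LamL Eeta.
have EVle : E * \prod_(k < N.+1) v (y k) ^+ 2 <= L * (T * T').
  rewrite prodrXl -/V.
  have V0 : 0 <= V.
    apply: prodr_ge0 => k _; apply: le_trans (vP k (ltn_ord k) x).
    exact/ltW.
  apply: (@le_trans _ _ (E * expR (M2 * N%:R) ^+ 2)).
    by rewrite ler_wpM2l// ler_pXn2r// nnegrE expR_ge0.
  set P := expR (- (M0 + M1 + M3) * N%:R).
  apply: (@le_trans _ _ (L * (P * P))).
    rewrite expr2 /E /L /P -!expRD ler_expR /K; lra.
  by rewrite ler_wpM2l// ler_pM ?expR_ge0.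
apply: tv_dist_filtering_le => // A mA.
set a := runnormalized Q g nu y N A; set a' := runnormalized Q g nu' y N A.
have := filter_determinant_le mg g_gt0 eta0 nu nu' mA L0 E0 vP outP pathP.
rewrite -/T -/T' -/a -/a' => det.
have -> : a / T - a' / T' = (a * T' - T * a') / (T * T').
  by field; rewrite !gt_eqF.
have TT0 : 0 < T * T' by rewrite mulr_gt0.
rewrite normrM normfV (gtr0_norm TT0) ler_pdivrMr// (le_trans det)// LE.
by rewrite (_ : 2 * L * (T * T') = L * (T * T') + L * (T * T')) ?lerD//; ring.
Qed.

End typical.

(** * Forgetting of the initial law *)

Theorem mainTheorem2 (R : realType) (dX dY dO : measure_display)
  (X : measurableType dX) (Y : measurableType dY) (Omega : measurableType dO)
  (cgX : countably_generated X) (cgY : countably_generated Y)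
  (Q : R.-pker X ~> X) (G : R.-pker X ~> Y)
  (mu : {measure set Y -> \bar R}) (g : X -> Y -> R)
  (mg : measurable_fun [set: X * Y] (fun xy : X * Y => g xy.1 xy.2))
  (densG : forall (x : X) (B : set Y), measurable B ->
     G x B = (\int[mu]_(y in B) (g x y)%:E)%E)
  (g_gt0 : forall (x : X) (y : Y), 0 < g x y)
  (Ceta : {posnum R} -> LD_set_function Y Q)
  (CetaP : forall (eta : {posnum R}) (y : Y),
     (Upsilon g (~` Ceta eta y) y <= eta%:num%:E * Upsilon g [set: X] y)%E)
  (Pstar : probability Omega R) (Yp : nat -> Omega -> Y)
  (mYp : forall k : nat, measurable_fun [set: Omega] (Yp k))
  (C : LD_set_function Y Q) (nu nu' : probability X R)
  (def_nu : forall (n : nat) (w : Omega), filter_defined Q g nu (Yp^~ w) n)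
  (def_nu' : forall (n : nat) (w : Omega), filter_defined Q g nu' (Yp^~ w) n)
  (M0 M1 M2 M3 delta alpha : R)
  (M0_gt0 : 0 < M0) (M1_gt0 : 0 < M1) (M2_gt0 : 0 < M2) (M3_gt0 : 0 < M3)
  (delta_gt0 : 0 < delta) (alpha01 : 0 < alpha < 1) :
  exists (eta : {posnum R}) (beta : R), 0 < beta < 1 /\
  forall n : nat,
  let r0 (xi : probability X R) := outer_prob Pstar
    [set w | (lne (Phi g xi C (Yp 0%N w) (Yp 1%N w)) <= (- M0 * n%:R)%:E)%E] in
  let r1 := outer_prob Pstar
    [set w | \sum_(2 <= k < n.+1) ln (eps_lo C (Yp k.-1 w) (Yp k w))
             <= - M1 * n%:R] in
  let r2 := outer_prob Pstar
    [set w | ((M2 * n%:R)%:E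
              <= \sum_(0 <= k < n.+1) lne (Upsilon g [set: X] (Yp k w)))%E] in
  let r3 := outer_prob Pstar
    [set w | (\sum_(2 <= k < n.+1) lne (Psi g C (Yp k.-1 w) (Yp k w))
              <= (- M3 * n%:R)%:E)%E] in
  let r4 := outer_prob Pstar
    [set w | ((- delta * n%:R)%:E
              <= lne (Lambda (Ceta eta) (Yp^~ w) n alpha))%E] in
  (\int[Pstar]_w tv_dist (filtering Q g nu (Yp^~ w) n)
                         (filtering Q g nu' (Yp^~ w) n)
   <= (2 * beta ^+ n)%:E + r0 nu + r0 nu' + (r1 + r2 + r3 + r4))%E.
Proof.
have mgt t : measurable_fun setT (g ^~ t).
  exact: measurableT_comp mg (pair2_measurable t).
have /andP[al0 al1] := alpha01.
set K := 2 * (M0 + M1 + M2 + M3) + delta.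
have K0 : 0 <= K by rewrite /K; lra.
have eta0 : 0 < expR (- (2 * K / (1 - alpha))) by exact: expR_gt0.
pose eta := PosNum eta0; exists eta, (expR (- delta)); split.
  by rewrite expR_gt0 -[ltRHS]expR0 ltr_expR oppr_lt0.
move=> n; cbv beta zeta.
set E0 := [set w | (lne (Phi g nu _ _ _) <= _)%E].
set E0' := [set w | (lne (Phi g nu' _ _ _) <= _)%E].
set E1 := [set w | \sum_(2 <= k < n.+1) _ <= _].
set E2 := [set w | (_ <= \sum_(0 <= k < n.+1) _)%E].
set E3 := [set w | (\sum_(2 <= k < n.+1) _ <= _)%E].
set E4 := [set w | (_ <= lne _)%E].
pose B := E0 `|` E0' `|` (E1 `|` E2 `|` E3 `|` E4).
apply: (@le_trans _ _ ((2 * expR (- delta) ^+ n)%:E + outer_prob Pstar B)%E).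
  apply: integral_le_outer_prob.
  - by rewrite mulr_ge0// exprn_ge0// expR_ge0.
  - by move=> w; exact: tv_dist_ge0.
  - by move=> w; exact: tv_dist_filtering_le1.
  move=> w Bw; have [n0|n0] := posnP n.
    apply: le_trans (tv_dist_filtering_le1 _ _ (def_nu n w) (def_nu' n w)) _
      => //.
    by rewrite n0 expr0 mulr1 lee_fin ler1n.
  apply: (@tv_dist_filtering_exp _ _ _ _ _ _ _ mgt g_gt0 C (Ceta eta) nu nu'
    (Yp^~ w) n eta%:num alpha delta M0 M1 M2 M3) => //.
  - by rewrite expRK.
  - by rewrite ltNge; apply/negP => h; apply: Bw; left; left.
  - by rewrite ltNge; apply/negP => h; apply: Bw; left; right.
  - by rewrite ltNge; apply/negP => h; apply: Bw; right; left; left; left.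
  - by rewrite ltNge; apply/negP => h; apply: Bw; right; left; left; right.
  - by rewrite ltNge; apply/negP => h; apply: Bw; right; left; right.
  - by rewrite ltNge; apply/negP => h; apply: Bw; right; right.
rewrite -2!addeA leeD2l// /B.
apply: le_trans (outer_probU2 _ _ _) _.
rewrite [leRHS]addeA; apply: leeD; first exact: outer_probU2.
apply: le_trans (outer_probU2 _ _ _) _; apply: leeD => //.
apply: le_trans (outer_probU2 _ _ _) _; apply: leeD => //.
exact: outer_probU2.
Qed.
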